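(* Let $M,K$ be integers with $1\le K\le M-1$, and let $W>0$ and $R>0$ be fixed. Let $P_{\mathrm{out}}(\phi)$ be the outage probability at average SNR $\phi>0$ of the system described in the context. Then the diversity order of the system is $M$, regardless of the number $K$ of activated ports; that is, $$\lim_{\phi\to\infty}\frac{-\log P_{\mathrm{out}}(\phi)}{\log\phi}=M .$$
   Context: Setting (fluid antenna system with $M$ ports, of which the best $K$ are activated and combined by maximum ratio combining, in Rayleigh fading). The correlation factor is $$\mu=\sqrt2\,\sqrt{{}_1F_2\big(\tfrac12;1,\tfrac32;-\pi^2W^2\big)-\frac{J_1(2\pi W)}{2\pi W}},$$ with ${}_1F_2$ the generalized hypergeometric function and $J_1$ the Bessel function of the first kind of order 1; it satisfies $0<\mu<1$. The average SNR is $\phi=P_S\alpha/\sigma^2>0$ ($P_S$ transmit power, $\alpha$ average channel gain, $\sigma^2$ noise power) and $\omega=(\phi(1-\mu))^{-1}$. The random variable $\gamma_0$ (SNR of a virtual reference port) has density $f_{\gamma_0}(x)=\frac1\phi e^{-x/\phi}$, $x\ge0$. Conditionally on $\gamma_0=x_0$, the port SNRs $\gamma_1,\dots,\gamma_M$ are independent and identically distributed with density $$f_{\gamma_m|\gamma_0=x_0}(x)=\omega e^{-\omega(x+\mu x_0)}I_0\big(2\omega\sqrt{\mu x_0x}\big),\qquad x\ge 0,$$ where $I_0(u)=\sum_{k\ge0}\frac{u^{2k}}{2^{2k}(k!)^2}$ is the modified Bessel function of the first kind of order 0. Let $\mathbb K\subset\{1,\dots,M\}$ be the (random) set of indices of the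 $K$ largest values among $\gamma_1,\dots,\gamma_M$. For the fixed data rate $R$, the outage probability is $P_{\mathrm{out}}=\Pr\big(\log_2(1+\sum_{m\in\mathbb K}\gamma_m)\le R\big)$, i.e. $P_{\mathrm{out}}=\Pr(\sum_{m\in\mathbb K}\gamma_m\le z)$ with $z=2^R-1$. The diversity order is the exponent of decay of the outage probability in the average SNR, $\lim_{\phi\to\infty}-\log P_{\mathrm{out}}(\phi)/\log\phi$. *)

(* Defs.v *)
From HB Require Import structures.
From mathcomp Require Import all_boot all_order all_algebra.
From mathcomp Require Import all_classical all_reals all_analysis.

Set Implicit Arguments.
Unset Strict Implicit.
Unset Printing Implicit Defensive.

Import Order.TTheory GRing.Theory Num.Theory.
Import numFieldNormedType.Exports.

Local Open Scope classical_set_scope.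
Local Open Scope ring_scope.

Section special_functions.
Context {R : realType}.
Implicit Types a b c x : R.

(* rising factorial a (a + 1) ... (a + k - 1) *)
Definition pochhammer a (k : nat) : R := \prod_(i < k) (a + i%:R).

Definition hyp1F2 a b c x : R :=
  limn (series (fun k : nat =>
    pochhammer a k / (pochhammer b k * pochhammer c k) * (x ^+ k / k`!%:R))).

(* Bessel function of the first kind J_n, of integer order n *)
Definition besselJ (n : nat) x : R :=
  limn (series (fun k : nat =>
    (-1) ^+ k / (k`!%:R * (k + n)`!%:R) * (x / 2) ^+ (k.*2 + n))).

(* modified Bessel function of the first kind, of order 0 *)
Definition besselI0 x : R :=
  limn (series (fun k : nat => x ^+ k.*2 / (2 ^+ k.*2 * k`!%:R ^+ 2))).

Definition log2 x : R := ln x / ln 2.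

End special_functions.

Section laws.
Context {R : realType} d {T : measurableType d} (P : probability T R).

Definition has_density (X : {RV P >-> R}) (f : R -> R) : Prop :=
  forall A : set R, measurable A ->
    distribution P X A = (\int[lebesgue_measure]_(x in A) (f x)%:E)%E.

(* Conditionally on X = x, the Y_i are independent, each with density g x:
   the product of the laws g x (y) dy is a regular conditional distribution
   of the family (Y_i)_i given X. *)
Definition cond_iid_density (n : nat) (X : {RV P >-> R})
    (Y : 'I_n -> {RV P >-> R}) (g : R -> R -> R) : Prop :=
  forall (A : set R) (B : 'I_n -> set R),
    measurable A -> (forall i, measurable (B i)) ->
    P (X @^-1` A `&` [set t | forall i, B i (Y i t)]) =
    (\int[distribution P X]_(x in A)
       \prod_(i < n) \int[lebesgue_measure]_(y in B i) (g x y)%:E)%E.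

End laws.

Section fluid_antenna_system.
Context {R : realType}.
Implicit Types W mu phi x : R.

Definition correlation W : R :=
  Num.sqrt 2 *
  Num.sqrt (hyp1F2 (1 / 2) 1 (3 / 2) (- (pi ^+ 2 * W ^+ 2)) -
            besselJ 1 (2 * pi * W) / (2 * pi * W)).

Definition omega mu phi : R := (phi * (1 - mu))^-1.

Definition reference_density phi : R -> R :=
  (fun x => 1 / phi * expR (- x / phi)) \_ `[0, +oo[.

Definition port_density mu phi (x0 : R) : R -> R :=
  (fun x => omega mu phi * expR (- (omega mu phi * (x + mu * x0))) *
     besselI0 (2 * omega mu phi * Num.sqrt (mu * x0 * x))) \_ `[0, +oo[.

(* Joint law of the SNRs of the reference port and of the M ports of an antenna
   of normalized size W, at average SNR phi. *)
Definition fas_snr W phi d (T : measurableType d) (P : probability T R)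
    (M : nat) (gamma0 : {RV P >-> R}) (gamma : 'I_M -> {RV P >-> R}) : Prop :=
  has_density gamma0 (reference_density phi) /\
  cond_iid_density gamma0 gamma (port_density (correlation W) phi).

(* S is a set of indices of K largest values of x; S is unique up to ties. *)
Definition largest (M K : nat) (x : 'I_M -> R) (S : {set 'I_M}) : Prop :=
  #|S| = K /\ forall i j, i \in S -> j \notin S -> x j <= x i.

Definition outage_probability (rate : R) d (T : measurableType d)
    (P : probability T R) (M : nat) (gamma : 'I_M -> {RV P >-> R})
    (best : T -> {set 'I_M}) : R :=
  fine (P [set t | log2 (1 + \sum_(m in best t) gamma m t) <= rate]).

Definition diversity_order_is (Pout : R -> R) (l : R) : Prop :=
  (fun phi => - ln (Pout phi) / ln phi) @ +oo --> l.

End fluid_antenna_system.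

(* Main.v *)
Require Import Defs.
From mathcomp Require Import all_boot all_order all_algebra.
From mathcomp Require Import all_classical all_reals all_analysis.
From mathcomp Require Import ring.
Import Order.TTheory GRing.Theory Num.Theory.
Import numFieldNormedType.Exports.
Local Open Scope classical_set_scope.
Local Open Scope ring_scope.

(** The port density is squeezed by elementary bounds: from
    [1 <= I0 u <= exp u] one gets
    [omega exp (- omega (y + mu x)) <= f (y | x) <= omega] for [x, y >= 0].
    Up to a null set the outage event forces every port below [z], and it occurs
    when every port is below [z / K].  By conditional independence
    the outage probability is thus at most [(omega z)^M], and, restricting to
    [gamma0 <= phi], an event of probability at least [1 / e], at least a
    constant times [omega^M].  As [omega] is proportional to [1 / phi],
    it is of exact order [phi^(-M)].

    The bound [mu < 1] needs no estimate of the hypergeometric and Bessel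
    series: for [1 <= mu] the port densities could not have total mass 1. *)

(** A nonnegative integral is a supremum over the simple functions below the integrand, a set that
    grows with the integrand. This lets port masses be bounded under the integral without a
    measurability proof in the reference value. *)
Lemma ge0_le_integral_nonmeasurable d (T : measurableType d) (R : realType)
    (mu : {measure set T -> \bar R}) (D : set T) (f g : T -> \bar R) :
  (forall x, D x -> (0 <= f x)%E) -> (forall x, D x -> (f x <= g x)%E) ->
  (\int[mu]_(x in D) f x <= \int[mu]_(x in D) g x)%E.
Proof.
move=> f0 fg; have g0 x : D x -> (0 <= g x)%E.
  by move=> Dx; exact: le_trans (f0 _ Dx) (fg _ Dx).
rewrite !ge0_integralE//; apply: ereal_sup_le; apply: image_subset => h /= hf x.
apply: le_trans (hf x) _; rewrite /patch.
by case: ifPn => // /set_mem; exact: fg.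
Qed.

(** * The modified Bessel function [I0] *)

Section bessel.
Context {R : realType}.
Implicit Type x : R.

Let coeff x := fun k : nat => x ^+ k.*2 / (2 ^+ k.*2 * k`!%:R ^+ 2) : R.

Let coeff_sqr x k : coeff x k = exp_coeff (x / 2) k ^+ 2.
Proof.
rewrite /coeff /exp_coeff /= !expr_div_n -!exprM -muln2.
by rewrite -[_ / _ / _]mulrA -invfM.
Qed.

Let series_coeff_nd x :
  {homo series (coeff x) : n m / (n <= m)%N >-> n <= m}.
Proof.
by apply: nondecreasing_series => n _ _; rewrite coeff_sqr sqr_ge0.
Qed.

Let series_coeff_le x n : 0 <= x -> series (coeff x) n <= expR x.
Proof.
move=> x0; have e0 k : 0 <= exp_coeff (x / 2) k by apply: exp_coeff_ge0; rewrite divr_ge0.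
have h : series (coeff x) n <= series (exp_coeff (x / 2)) n ^+ 2.
  elim: n => [|n IH]; first by rewrite /series /= !big_geq// expr0n.
  rewrite /series /= !big_nat_recr//= sqrrD coeff_sqr.
  rewrite lerD2r (le_trans IH)// lerDl mulrn_wge0// mulr_ge0//.
  by apply: sumr_ge0 => k _; exact: e0.
apply: (le_trans h).
have -> : expR x = expR (x / 2) ^+ 2 by rewrite -expRM_natl mulrC divfK.
rewrite lerXn2r ?nnegrE ?expR_ge0//; first by apply: sumr_ge0 => k _; exact: e0.
apply: nondecreasing_cvgn_le; last exact: is_cvg_series_exp_coeff.
by apply: nondecreasing_series => k _ _; exact: e0.
Qed.

Let is_cvg_series_coeff x : 0 <= x -> cvgn (series (coeff x)).
Proof.
move=> x0; apply: nondecreasing_is_cvgn; first exact: series_coeff_nd.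
by exists (expR x) => _ [n _ <-]; exact: series_coeff_le.
Qed.

(** Only even powers occur. This serves the case of negative [omega], where the argument of [I0] in
    the port density is nonpositive. *)
Let besselI0_norm x : besselI0 `|x| = besselI0 x.
Proof.
by rewrite /besselI0; congr (limn (series _)); apply/funext => k;
  rewrite -mul2n !exprM real_normK ?num_real.
Qed.

Lemma besselI0_ge1 x : 1 <= besselI0 x.
Proof.
rewrite -besselI0_norm.
(* The partial sum of index 1 is the constant term alone. *)
have := nondecreasing_cvgn_le (series_coeff_nd `|x|) (is_cvg_series_coeff _ (normr_ge0 x)) 1.
by rewrite /series /= big_nat1 /coeff /= !expr0 fact0 expr1n mulr1 divr1.
Qed.

(* With [u = x / 2], [I0 x] is the sum of the squares of [u ^ k / k!], hence at
   most the square of their sum [expR u]. *)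
Lemma besselI0_le_expR x : 0 <= x -> besselI0 x <= expR x.
Proof.
move=> x0; apply: limr_le; first exact: is_cvg_series_coeff.
by near=> n; exact: series_coeff_le.
Unshelve. all: by end_near.
Qed.

End bessel.

(** * Sums of the [K] largest values and the outage threshold *)

Section selection.
Context {R : realType} (M K : nat).

(** Subtract the least selected value [x m] from all terms: both sums lose [x m *+ K], the terms
    over the intersection cancel, and those left are nonpositive outside [S] and nonnegative
    inside. *)
Lemma largest_sum_max (x : 'I_M -> R) (S S' : {set 'I_M}) :
  (0 < K)%N -> largest K x S -> #|S'| = K ->
  \sum_(i in S') x i <= \sum_(i in S) x i.
Proof.
move=> K0 [cS hS] cS'.
have [i0 i0S] : exists i, i \in S by apply/card_gt0P; rewrite cS.
case: (Order.TotalTheory.arg_minP x i0S) => m mS minm.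
have shift (A : {set 'I_M}) : #|A| = K ->
    \sum_(i in A) x i = x m *+ K + \sum_(i in A) (x i - x m).
  by move=> cA; rewrite sumrB sumr_const cA addrC subrK.
rewrite (shift S)// (shift S')// lerD2l (big_setID S)/= [leRHS](big_setID S')/=.
rewrite finset.setIC lerD2l; apply: (@le_trans _ _ 0).
  apply: sumr_le0 => i /setDP[_ iS]; rewrite subr_le0; exact: hS.
by apply: sumr_ge0 => i /setDP[iS _]; rewrite subr_ge0; exact: minm.
Qed.

Lemma log2_le (rate s : R) : 0 < rate ->
  (log2 (1 + s) <= rate) = (s <= expR (rate * ln 2) - 1).
Proof.
move=> r0; have l2 : 0 < ln 2 :> R by rewrite ln_gt0// ltr1n.
rewrite /log2 ler_pdivrMr// lerBrDl.
have [s0|s0] := ltP 0 (1 + s).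
  by rewrite -ler_expR lnK.
(* For [1 + s <= 0] the default value of [ln] is 0, so the left side holds as [rate] is positive;
   the right side holds as well. *)
rewrite ln0// mulr_ge0 ?ltW//; apply/esym.
by rewrite (le_lt_trans s0) ?expR_gt0.
Qed.

End selection.

(** * Pointwise and integrated bounds for the port density *)

Section densities.
Context {R : realType}.
Implicit Types mu phi x y b : R.

(* [- (y + mu x) + 2 sqrt (mu x y) = - (sqrt y - sqrt (mu x))^2] compensates the
   growth of [I0]. *)
Lemma port_density_le mu phi x y :
  0 <= mu -> 0 <= omega mu phi -> 0 <= x -> port_density mu phi x y <= omega mu phi.
Proof.
move=> mu0 w0 x0; rewrite /port_density /patch; case: ifPn => // /set_mem /=.
rewrite in_itv /= andbT => y0.
rewrite -mulrA ler_piMr//.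
set w := omega mu phi in w0 *.
have u0 : 0 <= 2 * w * Num.sqrt (mu * x * y) by rewrite !mulr_ge0// sqrtr_ge0.
apply: (@le_trans _ _ (expR (- (w * (y + mu * x))) *
    expR (2 * w * Num.sqrt (mu * x * y)))).
  by rewrite ler_wpM2l ?expR_ge0// besselI0_le_expR.
rewrite -expRD -[leRHS]expR0 ler_expR.
have -> : - (w * (y + mu * x)) + 2 * w * Num.sqrt (mu * x * y) =
    - (w * (Num.sqrt y - Num.sqrt (mu * x)) ^+ 2).
  rewrite sqrrB !sqr_sqrtr ?mulr_ge0// sqrtrM ?mulr_ge0//; ring.
by rewrite oppr_le0 mulr_ge0// sqr_ge0.
Qed.

Lemma port_density_ge mu phi x y :
  0 <= omega mu phi -> 0 <= y ->
  omega mu phi * expR (- (omega mu phi * (y + mu * x))) <= port_density mu phi x y.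
Proof.
move=> w0 y0; rewrite /port_density /patch mem_set/=; last by rewrite in_itv/= y0.
rewrite ler_peMr ?mulr_ge0 ?expR_ge0//.
exact: besselI0_ge1.
Qed.

Lemma port_density_ge0 mu phi x y :
  0 <= omega mu phi -> 0 <= port_density mu phi x y.
Proof.
move=> w0; rewrite /port_density /patch; case: ifPn => // _.
by rewrite !mulr_ge0 ?expR_ge0// (le_trans ler01)// besselI0_ge1.
Qed.

Lemma port_mass_le mu phi x b :
  0 <= mu -> 0 <= omega mu phi -> 0 <= x -> 0 <= b ->
  (\int[lebesgue_measure]_(y in `[0%R, b]) (port_density mu phi x y)%:E <=
    (omega mu phi * b)%:E)%E.
Proof.
move=> mu0 w0 x0 b0.
apply: (@le_trans _ _ (\int[lebesgue_measure]_(y in `[0%R, b]) (omega mu phi)%:E)%E).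
  apply: ge0_le_integral_nonmeasurable => y _; rewrite lee_fin.
    exact: port_density_ge0.
  exact: port_density_le.
rewrite integral_cst//= lebesgue_measure_itv/= lte_fin.
case: ltP => _; last by rewrite mule0 lee_fin mulr_ge0.
by rewrite sube0 -EFinM.
Qed.

(** The cutoff [x <= phi] has the right scale: for [phi > 0], [omega mu phi * phi] is [(1 - mu)^-1],
    so the exponential factor does not degenerate as [phi] grows. *)
Lemma port_mass_ge mu phi x b :
  0 <= mu -> 0 <= omega mu phi -> 0 <= x -> x <= phi -> 0 < b ->
  ((omega mu phi * expR (- (omega mu phi * (b + mu * phi))) * b)%:E <=
  \int[lebesgue_measure]_(y in `[0%R, b]) (port_density mu phi x y)%:E)%E.
Proof.
move=> mu0 w0 x0 xphi b0.
set c := omega mu phi * _.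
have -> : ((c * b)%:E =
    \int[lebesgue_measure]_(y in `[0%R, b]) c%:E)%E.
  by rewrite integral_cst//= lebesgue_measure_itv/= lte_fin b0 sube0 -EFinM.
apply: ge0_le_integral_nonmeasurable => y; rewrite lee_fin.
  by rewrite mulr_ge0 ?expR_ge0.
rewrite /= in_itv /= => /andP[y0 yb].
apply: le_trans (port_density_ge _ _ _ _ w0 y0).
rewrite ler_wpM2l// ler_expR lerN2 ler_wpM2l// lerD// ler_wpM2l//.
Qed.

(** For negative [omega] the exponential and [I0] are both at least 1 on the half-line, so the
    density stays below the negative constant [omega] there and its integral diverges. *)
Lemma port_mass_nonpos_omega mu phi x :
  0 <= mu -> omega mu phi <= 0 -> 0 <= x ->
  (\int[lebesgue_measure]_y (port_density mu phi x y)%:E =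
    if omega mu phi == 0%R then 0 else -oo)%E.
Proof.
move=> mu0 w0 x0; set w := omega mu phi in w0 *.
have [w_eq0|w_neq0] := eqVneq w 0.
  rewrite integral0_eq// => y _; congr EFin.
  by rewrite /port_density /patch -/w w_eq0 !mul0r; case: ifP.
have {w_neq0}w_lt0 : w < 0 by rewrite lt_neqAle w_neq0.
have g_le y : 0 <= y -> port_density mu phi x y <= w.
  move=> y0; rewrite /port_density /patch mem_set/=; last by rewrite in_itv/= y0.
  rewrite -/w -mulrA ler_neMr// -[leLHS]mulr1 ler_pM// ?besselI0_ge1//.
  rewrite -[leLHS]expR0 ler_expR oppr_ge0 nmulr_rle0//.
  by rewrite addr_ge0// mulr_ge0.
have g_le0 y : port_density mu phi x y <= 0.
  have [y0|y0] := leP 0 y; first exact: le_trans (g_le _ y0) w0.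
  by rewrite /port_density /patch memNset//= in_itv/= andbT leNgt y0.
have -> : (\int[lebesgue_measure]_y (port_density mu phi x y)%:E =
    - \int[lebesgue_measure]_y (- port_density mu phi x y)%:E)%E.
  rewrite -integral_ge0N; last by move=> y _; rewrite lee_fin oppr_ge0.
  by apply: eq_integral => y _; rewrite EFinN oppeK.
suff -> : (\int[lebesgue_measure]_y (- port_density mu phi x y)%:E = +oo)%E by [].
apply/eqP; rewrite eq_le leey/=.
have <- : (\int[lebesgue_measure]_(y in `[0%R, +oo[) (- w)%:E = +oo)%E.
  by rewrite integral_cst//= lebesgue_measure_itv/= ltry mulry gtr0_sg ?oppr_gt0// mul1e.
rewrite [leLHS]integral_mkcond; apply: ge0_le_integral_nonmeasurable => y _;
  rewrite /patch; case: ifPn => [/set_mem|_];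
  rewrite /= ?in_itv/= ?andbT ?lee_fin ?oppr_ge0// => y0.
by rewrite lerN2 g_le.
Qed.

End densities.

(** * Finite products of extended reals *)

Section extended_products.
Local Open Scope ereal_scope.
Context {R : realType}.
Implicit Type n : nat.

Lemma prode_EFin n (a : R) : \prod_(i < n) a%:E = (a ^+ n)%:E.
Proof.
elim: n => [|n IH]; first by rewrite big_ord0 expr0.
by rewrite big_ord_recr/= IH -EFinM exprSr.
Qed.

Lemma lee_prod_ord n (f g : 'I_n -> \bar R) :
  (forall i, 0 <= f i) -> (forall i, f i <= g i) ->
  \prod_(i < n) f i <= \prod_(i < n) g i.
Proof.
move=> f0 fg; elim: n f g f0 fg => [|n IH] f g f0 fg; first by rewrite !big_ord0.
rewrite !big_ord_recr/=; apply: lee_pmul => //; first exact: prode_ge0.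
exact: IH.
Qed.

(** Since [0 * oo = 0], the values 0, [+oo] and [-oo] are stable under multiplication by 0 or [-oo].
    The index [n.+1] excludes the empty product 1. *)
Lemma prode_degenerate_neq1 n (b : bool) :
  \prod_(i < n.+1) (if b then 0 else -oo : \bar R) != 1.
Proof.
suff : \prod_(i < n.+1) (if b then 0 else -oo : \bar R) \in [:: 0; +oo; -oo].
  by rewrite !inE => /or3P[] /eqP ->//; rewrite eq_sym onee_neq0.
elim: n => [|n IH].
  by rewrite big_ord_recr big_ord0/= mul1e; case: b; rewrite !inE eqxx ?orbT.
rewrite big_ord_recr/=; move: IH; rewrite !inE => /or3P[] /eqP ->; case: b;
  by rewrite ?mule0 ?mul0e ?mulyNy ?mulNyNy eqxx ?orbT.
Qed.

End extended_products.

(** * Joint law of the reference port and the ports *)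

Section laws_of_ports.
Context {R : realType} {d : measure_display} {T : measurableType d} {P : probability T R}.

Lemma reference_support phi (X : {RV P >-> R}) :
  has_density X (reference_density phi) -> distribution P X `[0, +oo[ = 1%E.
Proof.
move=> hX; rewrite -setCitvl probability_setC//=.
suff -> : distribution P X `]-oo, 0[ = 0%E by rewrite sube0.
rewrite hX// integral0_eq// => x; rewrite /= in_itv/= => x0; congr EFin.
by rewrite /reference_density /patch memNset//= in_itv/= andbT leNgt x0.
Qed.

(** On this window of length [phi] the density is at least [phi^-1 * expR (-1)]. *)
Lemma reference_window phi (X : {RV P >-> R}) : 0 < phi ->
  has_density X (reference_density phi) ->
  ((expR (-1))%:E <= distribution P X `[0%R, phi])%E.
Proof.
move=> phi0 hX; rewrite hX//.
set c := expR _.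
have -> : (c%:E =
    \int[lebesgue_measure]_(y in `[0%R, phi]) (phi^-1 * c)%:E)%E.
  rewrite integral_cst//= lebesgue_measure_itv/= lte_fin phi0 sube0 -EFinM.
  by rewrite mulrAC mulVf ?gt_eqF// mul1r.
apply: ge0_le_integral_nonmeasurable => x; rewrite lee_fin.
  by rewrite mulr_ge0 ?expR_ge0// invr_ge0 ltW.
rewrite /= in_itv /= => /andP[x0 xphi].
rewrite /reference_density /patch mem_set/=; last by rewrite in_itv/= x0.
rewrite div1r ler_wpM2l ?invr_ge0 ?(ltW phi0)// ler_expR mulNr lerN2.
by rewrite ler_pdivrMr// mul1r.
Qed.

Context {M : nat} {X : {RV P >-> R}} {Y : 'I_M -> {RV P >-> R}} {W phi : R}.
Context (phi0 : 0 < phi) (hXY : fas_snr W phi X Y).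

Lemma measurable_reference_ports (A B : set R) : measurable A -> measurable B ->
  measurable (X @^-1` A `&` [set t | forall i, B (Y i t)]).
Proof.
move=> mA mB; apply: measurableI; first exact: measurable_funPTI.
have -> : [set t | forall i, B (Y i t)] = \bigcap_(i in setT) (Y i @^-1` B).
  by apply/seteqP; split => [t h i _|t h i]; exact: h.
by apply: fin_bigcap_measurable => // i _; exact: measurable_funPTI.
Qed.

Let mu := correlation W.

(** [Num.sqrt] is nonnegative everywhere, with default value 0 on negative arguments. *)
Let mu_ge0 : 0 <= mu.
Proof. by rewrite mulr_ge0// sqrtr_ge0. Qed.

(* For [1 <= mu], [omega <= 0] (including the junk value [0^-1 = 0]) and every
   conditional port mass is [0] or [-oo], so that the law of the ports cannot
   have total mass 1. *)
Lemma fas_snr_correlation_lt1 : (0 < M)%N -> correlation W < 1.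
Proof.
case: hXY => hX hY M0; rewrite ltNge; apply/negP => mu1.
have w0 : omega mu phi <= 0 by rewrite invr_le0 pmulr_rle0// subr_le0.
have := hY `[0, +oo[%classic (fun=> setT) (measurable_itv _) (fun=> measurableT).
have -> : [set t : T | forall i : 'I_M, setT (Y i t)] = setT by apply/seteqP; split.
rewrite setIT.
have -> : P (X @^-1` `[0, +oo[) = 1%E by exact: reference_support hX.
have -> : (\int[distribution P X]_(x in `[0%R, +oo[) \prod_(i < M)
    \int[lebesgue_measure]_y (port_density mu phi x y)%:E =
  \int[distribution P X]_(x in `[0%R, +oo[) \prod_(i < M)
    (if omega mu phi == 0%R then 0 else -oo))%E.
  apply: eq_integral => x /set_mem; rewrite /= in_itv/= andbT => x0.
  by apply: eq_bigr => i _; exact: port_mass_nonpos_omega.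
rewrite integral_cst//= (reference_support _ _ hX) mule1.
case: M M0 => // n _ /esym/eqP; apply/negP; exact: prode_degenerate_neq1.
Qed.

(** The constraint on [X] costs no probability and gives access to the density bounds, which hold
    for nonnegative reference values. *)
Let box b := X @^-1` `[0, +oo[ `&` [set t | forall i, `[0, b]%classic (Y i t)].

Lemma port_box_le b : (0 < M)%N -> 0 <= b ->
  (P (box b) <= ((omega mu phi * b) ^+ M)%:E)%E.
Proof.
move=> M0 b0; case: (hXY) => hX hY; rewrite (hY _ (fun=> `[0, b]%classic))//.
have w0 : 0 <= omega mu phi.
  by rewrite invr_ge0 mulr_ge0 ?(ltW phi0)// subr_ge0 ltW// fas_snr_correlation_lt1.
apply: (@le_trans _ _ (\int[distribution P X]_(x in `[0%R, +oo[)
   ((omega mu phi * b) ^+ M)%:E)%E); last first.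
  by rewrite integral_cst//= (reference_support _ _ hX) mule1.
have m0 x : (0 <= \int[lebesgue_measure]_(y in `[0%R, b]) (port_density mu phi x y)%:E)%E.
  by apply: integral_ge0 => y _; rewrite lee_fin port_density_ge0.
apply: ge0_le_integral_nonmeasurable => x; first by rewrite prode_ge0.
rewrite /= in_itv/= andbT => x0; rewrite -prode_EFin; apply: lee_prod_ord => i//.
exact: port_mass_le.
Qed.

Lemma port_box_ge b : (0 < M)%N -> 0 < b ->
  (((omega mu phi * expR (- (omega mu phi * (b + mu * phi))) * b) ^+ M *
     expR (-1))%:E <= P (box b))%E.
Proof.
move=> M0 b0; case: (hXY) => hX hY.
have w0 : 0 <= omega mu phi.
  by rewrite invr_ge0 mulr_ge0 ?(ltW phi0)// subr_ge0 ltW// fas_snr_correlation_lt1.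
set c := _ ^+ M.
have c0 : 0 <= c by rewrite exprn_ge0// !mulr_ge0 ?expR_ge0// ltW.
(* Cutting the reference range down to [[0, phi]] makes the bound on each port mass uniform in [x],
   at the price of the factor [expR (-1)]. *)
apply: (@le_trans _ _ (P (X @^-1` `[0, phi] `&` [set t | forall i, `[0, b]%classic (Y i t)]))).
  rewrite (hY _ (fun=> `[0, b]%classic))//.
  apply: (@le_trans _ _ (\int[distribution P X]_(x in `[0%R, phi]) c%:E)%E).
    by rewrite integral_cst//= EFinM lee_wpmul2l ?lee_fin// reference_window.
  apply: ge0_le_integral_nonmeasurable => x; rewrite /= ?lee_fin//.
  rewrite in_itv/= => /andP[x0 xphi]; rewrite -prode_EFin; apply: lee_prod_ord => i.
    by rewrite lee_fin !mulr_ge0 ?expR_ge0// ltW.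
  exact: port_mass_ge.
apply: le_measure; rewrite ?inE; try exact: measurable_reference_ports.
apply: setSI => t; rewrite /= !in_itv/= andbT; by case/andP.
Qed.

(** The port density vanishes off the half-line, so its masses over the half-line and over the whole
    line agree. *)
Lemma fas_snr_ae_ge0 :
  P (X @^-1` `[0, +oo[ `&` [set t | forall i, `[0, +oo[%classic (Y i t)]) = 1%E.
Proof.
case: (hXY) => hX hY.
transitivity (P (X @^-1` `[0, +oo[ `&` [set t | forall i, setT (Y i t)])).
  rewrite (hY _ (fun=> `[0, +oo[%classic) (measurable_itv _) (fun=> measurable_itv _)).
  rewrite (hY _ (fun=> setT) (measurable_itv _) (fun=> measurableT)).
  apply: eq_integral => x _; apply: eq_bigr => i _.
  rewrite integral_mkcond; apply: eq_integral => y _.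
  by rewrite /port_density /patch; case: ifPn => [->|].
have -> : [set t : T | forall i : 'I_M, setT (Y i t)] = setT by apply/seteqP; split.
by rewrite setIT; exact: reference_support hX.
Qed.

End laws_of_ports.

(** * Two-sided bounds for the outage probability at fixed [phi] *)

Section outage.
Context {R : realType} {d : measure_display} {T : measurableType d} {P : probability T R}.
Context {M K : nat} {W phi rate : R} {X : {RV P >-> R}} {Y : 'I_M -> {RV P >-> R}}.
Context {best : T -> {set 'I_M}}.
Context (K0 : (0 < K)%N) (KM : (K <= M)%N) (rate0 : 0 < rate) (phi0 : 0 < phi).
Context (hXY : fas_snr W phi X Y).
Context (hbest : forall t, largest K (fun m => Y m t) (best t)).

Let mu := correlation W.
Let z := expR (rate * ln 2) - 1.

Let M0 : (0 < M)%N. Proof. exact: leq_trans KM. Qed.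

Let z0 : 0 < z.
Proof. by rewrite subr_gt0 expR_gt1 mulr_gt0// ln_gt0// ltr1n. Qed.

Let outage := [set t | log2 (1 + \sum_(m in best t) Y m t) <= rate].

(* [best] need not be measurable; the sum over it is, being a maximum over the
   finitely many sets of [K] ports. *)
Lemma measurable_outage : measurable outage.
Proof.
have -> : outage = \bigcap_(S in [set S : {set 'I_M} | #|S| = K])
    [set t | \sum_(m in S) Y m t <= z].
  apply/seteqP; split => t /=; rewrite /outage/= log2_le// -/z => h.
    by move=> S /= cS; apply: le_trans h; exact: largest_sum_max (hbest t) cS.
  by apply: (h (best t)); case: (hbest t).
apply: fin_bigcap_measurable => [|S _]; first exact: finite_finset.
rewrite -[X in measurable X]setTI; apply: measurable_fun_le => //.
under eq_fun do rewrite -big_filter.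
by apply: measurable_sum => m; exact: measurable_funPT.
Qed.

Let Pout := outage_probability rate Y best.

Let PoutE : P outage = Pout%:E.
Proof.
rewrite /Pout /outage_probability fineK// ge0_fin_numE//.
by rewrite (le_lt_trans (probability_le1 _ measurable_outage))// ltry.
Qed.

(** Outage forces all [M] ports below [z], not just the [K] selected ones: hence an exponent
    independent of [K]. *)
Lemma outage_probability_le : Pout <= (omega mu phi * z) ^+ M.
Proof.
rewrite -lee_fin -PoutE; apply: le_trans (port_box_le phi0 hXY z M0 (ltW z0)).
set N := X @^-1` `[0, +oo[ `&` [set t | forall i, `[0, +oo[%classic (Y i t)].
have mN : measurable N by exact: measurable_reference_ports.
have PN : P (~` N) = 0%E by rewrite probability_setC// (fas_snr_ae_ge0 hXY) subee.
(* Ports are nonnegative only almost surely; the part of the outage event outside [N] is null. *)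
have -> : P outage = P (outage `&` N).
  rewrite -[in LHS](setIT outage) -(setUv N) setIUr measureU0//.
  - by apply: measurableI => //; exact: measurable_outage.
  - by apply: measurableI; [exact: measurable_outage|exact: measurableC].
  - apply: (subset_measure0 _ _ _ PN); last exact: subIsetr.
      by apply: measurableI; [exact: measurable_outage|exact: measurableC].
    exact: measurableC.
apply: le_measure; rewrite ?inE; [|exact: measurable_reference_ports|].
  by apply: measurableI => //; exact: measurable_outage.
move=> t [ht [tX tY]]; split => // i.
have Y0 j : 0 <= Y j t by have := tY j; rewrite /= in_itv/= andbT.
rewrite /= in_itv/= Y0/=; move: ht; rewrite /outage/= log2_le// -/z.
apply: le_trans.
(* A selected port is at most the sum of nonnegative terms; an unselected one is at most any
   selected port, and one exists as [K > 0]. *)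
have [cB hB] := hbest t; have [iB|iB] := boolP (i \in best t).
  by rewrite (bigD1 i)//= lerDl sumr_ge0.
have [j jB] : exists j, j \in best t by apply/card_gt0P; rewrite cB.
by rewrite (bigD1 j)//= (le_trans (hB j i jB iB))// lerDl sumr_ge0.
Qed.

Lemma outage_probability_ge b : 0 < b -> b *+ K <= z ->
  (omega mu phi * expR (- (omega mu phi * (b + mu * phi))) * b) ^+ M * expR (-1)
    <= Pout.
Proof.
move=> b0 bz; rewrite -lee_fin -PoutE; apply: le_trans (port_box_ge phi0 hXY b M0 b0) _.
apply: le_measure; rewrite ?inE; [exact: measurable_reference_ports|exact: measurable_outage|].
move=> t [_ h]; rewrite /outage/= log2_le// -/z.
have [cB _] := hbest t.
apply: (@le_trans _ _ (\sum_(m in best t) b)).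
  by apply: ler_sum => i _; have := h i; rewrite /= in_itv/= => /andP[].
by rewrite sumr_const cB.
Qed.

End outage.

(** * From power bounds to the decay exponent *)

Lemma diversity_order_is_power (R : realType) (f : R -> R) (M : nat) (c C : R) :
  0 < c ->
  (forall phi, 1 <= phi -> c * phi^-1 ^+ M <= f phi <= C * phi^-1 ^+ M) ->
  diversity_order_is f M%:R.
Proof.
move=> c0 h.
have C0 : 0 < C.
  have /andP[] := h 1 (lexx _); rewrite invr1 expr1n !mulr1 => h1 h2.
  exact: lt_le_trans c0 (le_trans h1 h2).
have ln_inv_cvg0 : (ln x)^-1 @[x --> +oo] --> (0 : R).
  apply/cvgrPdist_lt => e e0; near=> x.
  have xe : expR e^-1 < x by near: x; apply: nbhs_pinfty_gt; rewrite num_real.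
  have x0 : 0 < x := lt_trans (expR_gt0 _) xe.
  have l : e^-1 < ln x by rewrite -ltr_expR lnK.
  have lx : 0 < ln x by apply: lt_trans l; rewrite invr_gt0.
  by rewrite sub0r normrN gtr0_norm ?invr_gt0// invf_plt ?posrE.
have lim a : (M%:R - a / ln x) @[x --> +oo] --> (M%:R : R).
  rewrite -[X in _ --> X]subr0; apply: cvgB; first exact: cvg_cst.
  by rewrite -[X in _ --> X](mulr0 a); apply: cvgM => //; exact: cvg_cst.
(* [- ln] reverses the order, so the upper constant [C] yields the lower envelope. *)
apply: squeeze_cvgr (lim (ln C)) (lim (ln c)).
near=> phi.
have phi1 : 1 < phi by near: phi; apply: nbhs_pinfty_gt; rewrite num_real.
have phi0 : 0 < phi := lt_trans ltr01 phi1.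
have l0 : 0 < ln phi by rewrite ln_gt0.
have p0 : 0 < phi^-1 ^+ M by rewrite exprn_gt0// invr_gt0.
have lnp a : 0 < a -> - ln (a * phi^-1 ^+ M) / ln phi = M%:R - ln a / ln phi.
  move=> a0; rewrite lnM ?posrE// lnXn ?invr_gt0// lnV ?posrE// -mulr_natl.
  by field; rewrite gt_eqF.
have /andP[h1 h2] := h phi (ltW phi1).
have f0 : 0 < f phi by apply: lt_le_trans h1; rewrite mulr_gt0.
by rewrite -!lnp// !ler_wpM2r ?invr_ge0 ?(ltW l0)// ?lerN2 ?ler_ln ?posrE ?mulr_gt0//.
Unshelve. all: by end_near.
Qed.

Theorem mainTheorem4 (R : realType) (M K : nat) (W rate : R)
  (d : R -> measure_display) (T : forall phi : R, measurableType (d phi))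
  (P : forall phi : R, probability (T phi) R)
  (gamma0 : forall phi : R, {RV (P phi) >-> R})
  (gamma : forall phi : R, 'I_M -> {RV (P phi) >-> R})
  (best : forall phi : R, T phi -> {set 'I_M}) :
  (1 <= K <= M - 1)%N -> 0 < W -> 0 < rate ->
  (forall phi : R, 0 < phi -> fas_snr W phi (gamma0 phi) (gamma phi)) ->
  (forall phi : R, 0 < phi -> forall t : T phi,
     largest K (fun m => gamma phi m t) (best phi t)) ->
  diversity_order_is
    (fun phi => outage_probability rate (gamma phi) (best phi)) M%:R.
Proof.
move=> /andP[K0 KM1] W0 rate0 hfas hbest.
have KM : (K <= M)%N := leq_trans KM1 (leq_subr _ _).
set mu := correlation W; set z := expR (rate * ln 2) - 1.
(* The correlation does not depend on [phi], so the system at [phi = 1] suffices. *)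
have mu1 : mu < 1.
  exact: fas_snr_correlation_lt1 ltr01 (hfas 1 ltr01) (leq_trans K0 KM).
have z0 : 0 < z by rewrite subr_gt0 expR_gt1 mulr_gt0// ln_gt0// ltr1n.
have [b b0 bz] : exists2 b, 0 < b & b *+ K <= z.
  exists (z / K%:R); first by rewrite divr_gt0// ltr0n.
  by rewrite -[leLHS]mulr_natr divfK// pnatr_eq0 -lt0n.
set v := (1 - mu)^-1; have v0 : 0 < v by rewrite invr_gt0 subr_gt0.
have omegaE phi : omega mu phi = v * phi^-1 by rewrite /omega invfM mulrC.
(* For [phi >= 1] the exponent [omega mu phi * (b + mu * phi)], equal to [v * (b / phi + mu)], is at
   most [v * (b + mu)]; this gives the lower constant. *)
apply: (@diversity_order_is_power R _ M
  ((v * expR (- (v * (b + mu))) * b) ^+ M * expR (-1)) ((v * z) ^+ M)).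
  have e0 : 0 < v * expR (- (v * (b + mu))) by rewrite mulr_gt0 ?expR_gt0.
  by apply: mulr_gt0; [apply: exprn_gt0; exact: mulr_gt0|exact: expR_gt0].
move=> phi phi1; have phi0 : 0 < phi := lt_le_trans ltr01 phi1.
have pV0 : 0 < phi^-1 by rewrite invr_gt0.
apply/andP; split; last first.
  have := outage_probability_le K0 KM rate0 phi0 (hfas _ phi0) (hbest _ phi0).
  by rewrite -/mu -/z omegaE -exprMn mulrAC.
apply: le_trans (outage_probability_ge K0 KM rate0 phi0 (hfas _ phi0)
  (hbest _ phi0) b b0 bz).
rewrite -/mu omegaE mulrAC ler_wpM2r ?expR_ge0// -exprMn.
rewrite lerXn2r ?nnegrE ?mulr_ge0 ?expR_ge0 ?(ltW v0) ?(ltW b0) ?(ltW pV0)//.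
rewrite [leLHS]mulrAC ler_wpM2r ?(ltW b0)// [leLHS]mulrAC.
rewrite ler_wpM2l ?mulr_ge0 ?(ltW v0) ?(ltW pV0)// ler_expR lerN2.
rewrite -mulrA ler_wpM2l ?(ltW v0)// mulrDr mulrCA mulVf ?gt_eqF// mulr1 lerD2r.
by rewrite ler_piMl ?(ltW b0)// invf_le1.
Qed.
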